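(* Regarding three-term sequences (non-increasing triples of positive integers): the cycle $C_3$ realizes only $(1,1,1)$, and $C_4$ realizes no three-term sequence. Suppose $n\ge 5$ and write $n=12k+j$ with integers $k\ge 0$ and $0\le j<12$. Define the set $R_n$ of triples as follows, according to $j$: \begin{itemize} \item $j=0$: $(6k-2i,\,4i,\,4i)$ for $1\le i\le k$; \item $j=1$: $(6k-2i+1,\,4i-1,\,4i-1)$ for $1\le i\le k$; \item $j=2$: $(6k-2i+2,\,4i-2,\,4i-2)$ for $1\le i\le k$, and $(4k,4k,4k)$; \item $j=3$: $(6k-2i+1,\,4i+1,\,4i+1)$ for $0\le i\le k$; \item $j=4$: $(6k-2i+2,\,4i,\,4i)$ for $1\le i\le k$; \item $j=5$: $(6k-2i+3,\,4i-1,\,4i-1)$ for $1\le i\le k$, and $(4k+1,4k+1,4k+1)$; \item $j=6$: $(6k-2i+2,\,4i+2,\,4i+2)$ for $0\le i\le k$; \item $j=7$: $(6k-2i+3,\,4i+1,\,4i+1)$ for $0\le i\le k$; \item $j=8$: $(6k-2i+4,\,4i,\,4i)$ for $1\le i\le k$, and $(4k+2,4k+2,4k+2)$; \item $j=9$: $(6k-2i+3,\,4i+3,\,4i+3)$ for $0\le i\le k$; \item $j=10$: $(6k-2i+4,\,4i+2,\,4i+2)$ for $0\le i\le k$; \item $j=11$: $(6k-2i+5,\,4i+1,\,4i+1)$ for $0\le i\le k$, and $(4k+3,4k+3,4k+3)$. \end{itemize} Define the set $U_n$ of triples as follows, according to $j$: \begin{itemize} \item $j=0$: $(6k-2i+1,\,\max\{4i-3,1\},\,1)$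 for $1\le i\le k$; \item $j=1$: $(6k-2i,\,\max\{4i,1\},\,1)$ for $0\le i\le k$; \item $j=2$: $(6k-2i+1,\,\max\{4i-1,1\},\,1)$ for $0\le i\le k$; \item $j=3$: $(6k-2i+2,\,\max\{4i-2,1\},\,1)$ for $0\le i\le k$; \item $j=4$: $(6k-2i+1,\,\max\{4i+1,1\},\,1)$ for $0\le i\le k$; \item $j=5$: $(6k-2i+2,\,\max\{4i,1\},\,1)$ for $0\le i\le k$; \item $j=6$: $(6k-2i+3,\,\max\{4i-1,1\},\,1)$ for $0\le i\le k$; \item $j=7$: $(6k-2i+2,\,\max\{4i+2,1\},\,1)$ for $-1\le i\le k$; \item $j=8$: $(6k-2i+3,\,\max\{4i+1,1\},\,1)$ for $0\le i\le k$; \item $j=9$: $(6k-2i+4,\,\max\{4i,1\},\,1)$ for $0\le i\le k$; \item $j=10$: $(6k-2i+3,\,\max\{4i+3,1\},\,1)$ for $-1\le i\le k$; \item $j=11$: $(6k-2i+4,\,\max\{4i+2,1\},\,1)$ for $-1\le i\le k$. \end{itemize} Then every triple in $R_n$ is a maximal three-term sequence realized by $C_n$, every triple in $U_n$ is a minimal three-term sequence not realized by $C_n$, and together they determine all three-term sequences realized by $C_n$: every three-term sequence either is $\le$ some element of $R_n$ (and is then realized by $C_n$) or is $\ge$ some element of $U_n$ (and is then not realized by $C_n$).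
   Context: $C_n$ denotes the cycle on $n$ vertices. Given a proper coloring of a graph $G$, a vertex $v$ is a color-dominating vertex (CDV) if its closed neighborhood $N[v]$ contains all colors used in the coloring. A b-coloring is a proper coloring in which every color class contains at least one CDV. A three-term sequence is a non-increasing triple of positive integers. A graph $G$ realizes $(s_1,s_2,s_3)$ if $G$ has a b-coloring with exactly $3$ colors in which, for each $i\in\{1,2,3\}$, the $i$th color class contains at least $s_i$ CDVs. For triples, $S\le T$ means $s_i\le t_i$ for every $i$; maximal and minimal refer to this partial order on three-term sequences. *)

(* Defs.v *)
From mathcomp Require Import all_boot all_order all_algebra.

Set Implicit Arguments.
Unset Strict Implicit.
Unset Printing Implicit Defensive.

Import Order.TTheory GRing.Theory Num.Theory.
Local Open Scope ring_scope.

(* A graph on the vertex set T is given by its adjacency relation e. *)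
Section BColoring.
Variables (T C : finType) (e : rel T) (c : {ffun T -> C}).

Definition closed_nbhd (v : T) : {set T} := [set u | (u == v) || e v u].

Definition proper_coloring : Prop := forall u v, e u v -> c u != c v.

Definition colors_used : {set C} := [set c v | v : T].

Definition is_CDV (v : T) : bool := colors_used \subset c @: closed_nbhd v.

Definition class_CDVs (a : C) : {set T} := [set v | (c v == a) && is_CDV v].

Definition b_coloring : Prop :=
  proper_coloring /\
  forall a, a \in colors_used -> exists v, v \in class_CDVs a.

End BColoring.

(* Entries are taken in int, not nat, so that the families below, whose
   formulas involve subtraction and an index i that may be -1, are evaluated
   without truncation. *)
Definition triple := 3.-tuple int.

Definition three_term (s : triple) : Prop :=
  (forall i, 0 < tnth s i) /\
  (forall i j : 'I_3, (i <= j)%N -> tnth s j <= tnth s i).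

Definition triple_le (s t : triple) : Prop := forall i, tnth s i <= tnth t i.

Definition realizes (T : finType) (e : rel T) (s : triple) : Prop :=
  exists c : {ffun T -> 'I_3},
    [/\ b_coloring e c, #|colors_used c| = 3%N &
        forall i, tnth s i <= #|class_CDVs e c i|%:Z].

Definition maximal_realized (T : finType) (e : rel T) (s : triple) : Prop :=
  [/\ three_term s, realizes e s &
      forall t, three_term t -> realizes e t -> triple_le s t -> t = s].

Definition minimal_not_realized (T : finType) (e : rel T) (s : triple) : Prop :=
  [/\ three_term s, ~ realizes e s &
      forall t, three_term t -> ~ realizes e t -> triple_le t s -> t = s].

(* ordS is the successor modulo n; this relation is irreflexive, hence a
   simple graph, and it is the cycle C_n, only for n >= 3. *)
Definition cycle_graph (n : nat) : rel 'I_n :=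
  fun u v => (v == ordS u) || (u == ordS v).

Definition family (lo hi : int) (f : int -> triple) (t : triple) : Prop :=
  exists i : int, lo <= i <= hi /\ t = f i.

(* R_set k j is R_n and U_set k j is U_n for n = 12 * k + j, j < 12. *)
Definition R_set (k j : nat) (t : triple) : Prop :=
  let K := k%:Z in
  match j with
  | 0%N => family 1 K (fun i => [tuple 6 * K - 2 * i; 4 * i; 4 * i]) t
  | 1%N =>
      family 1 K (fun i => [tuple 6 * K - 2 * i + 1; 4 * i - 1; 4 * i - 1]) t
  | 2%N =>
      family 1 K (fun i => [tuple 6 * K - 2 * i + 2; 4 * i - 2; 4 * i - 2]) t
      \/ t = [tuple 4 * K; 4 * K; 4 * K]
  | 3%N =>
      family 0 K (fun i => [tuple 6 * K - 2 * i + 1; 4 * i + 1; 4 * i + 1]) t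
  | 4%N => family 1 K (fun i => [tuple 6 * K - 2 * i + 2; 4 * i; 4 * i]) t
  | 5%N =>
      family 1 K (fun i => [tuple 6 * K - 2 * i + 3; 4 * i - 1; 4 * i - 1]) t
      \/ t = [tuple 4 * K + 1; 4 * K + 1; 4 * K + 1]
  | 6%N =>
      family 0 K (fun i => [tuple 6 * K - 2 * i + 2; 4 * i + 2; 4 * i + 2]) t
  | 7%N =>
      family 0 K (fun i => [tuple 6 * K - 2 * i + 3; 4 * i + 1; 4 * i + 1]) t
  | 8%N =>
      family 1 K (fun i => [tuple 6 * K - 2 * i + 4; 4 * i; 4 * i]) t
      \/ t = [tuple 4 * K + 2; 4 * K + 2; 4 * K + 2]
  | 9%N =>
      family 0 K (fun i => [tuple 6 * K - 2 * i + 3; 4 * i + 3; 4 * i + 3]) t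
  | 10%N =>
      family 0 K (fun i => [tuple 6 * K - 2 * i + 4; 4 * i + 2; 4 * i + 2]) t
  | 11%N =>
      family 0 K (fun i => [tuple 6 * K - 2 * i + 5; 4 * i + 1; 4 * i + 1]) t
      \/ t = [tuple 4 * K + 3; 4 * K + 3; 4 * K + 3]
  | _ => False
  end.

Definition U_set (k j : nat) (t : triple) : Prop :=
  let K := k%:Z in
  match j with
  | 0%N =>
      family 1 K (fun i => [tuple 6 * K - 2 * i + 1; Num.max (4 * i - 3) 1; 1]) t
  | 1%N =>
      family 0 K (fun i => [tuple 6 * K - 2 * i; Num.max (4 * i) 1; 1]) t
  | 2%N =>
      family 0 K (fun i => [tuple 6 * K - 2 * i + 1; Num.max (4 * i - 1) 1; 1]) t
  | 3%N =>
      family 0 K (fun i => [tuple 6 * K - 2 * i + 2; Num.max (4 * i - 2) 1; 1]) t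
  | 4%N =>
      family 0 K (fun i => [tuple 6 * K - 2 * i + 1; Num.max (4 * i + 1) 1; 1]) t
  | 5%N =>
      family 0 K (fun i => [tuple 6 * K - 2 * i + 2; Num.max (4 * i) 1; 1]) t
  | 6%N =>
      family 0 K (fun i => [tuple 6 * K - 2 * i + 3; Num.max (4 * i - 1) 1; 1]) t
  | 7%N =>
      family (-1) K
        (fun i => [tuple 6 * K - 2 * i + 2; Num.max (4 * i + 2) 1; 1]) t
  | 8%N =>
      family 0 K (fun i => [tuple 6 * K - 2 * i + 3; Num.max (4 * i + 1) 1; 1]) t
  | 9%N =>
      family 0 K (fun i => [tuple 6 * K - 2 * i + 4; Num.max (4 * i) 1; 1]) t
  | 10%N =>
      family (-1) K
        (fun i => [tuple 6 * K - 2 * i + 3; Num.max (4 * i + 3) 1; 1]) t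
  | 11%N =>
      family (-1) K
        (fun i => [tuple 6 * K - 2 * i + 4; Num.max (4 * i + 2) 1; 1]) t
  | _ => False
  end.

(* Main.v *)
(* In a proper 3-coloring of a cycle with t_i CDVs of color i, let E_ij be the
   number of edges with colors i and j.  Summing over the vertices of color i,
   a CDV contributes 1 to E_ij and any other vertex 0 or 2, so E_ij is at least
   t_i and has its parity.  As n = E_ij + E_il + E_jl, this gives n = 2 t_i + t_j
   modulo 2 and 2 t_i + t_j <= n.  Conversely the closed word
   (012)^b (0102)^e (02)^d realizes (b + 2e, b, b).  Hence (a, b, c) is realized
   by C_n iff 2 a' + b' <= n, where a' and b' are the least integers of the
   parity of n with a <= a' and b <= b'; the families follow by arithmetic. *)
Require Import Defs.
From mathcomp Require Import all_boot all_order all_algebra.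
From mathcomp Require Import zify.
Set Implicit Arguments.
Unset Strict Implicit.
Unset Printing Implicit Defensive.

Import Order.TTheory GRing.Theory Num.Theory.
Local Open Scope ring_scope.

(** * Necessity: counting the edges of a 3-colored cycle *)

Lemma ord3_exhausted (x y z w : 'I_3) :
  x != y -> x != z -> y != z -> [|| w == x, w == y | w == z].
Proof.
rewrite -!val_eqE /=.
by move: (ltn_ord x) (ltn_ord y) (ltn_ord z) (ltn_ord w); lia.
Qed.

Section CycleColoring.
Variables (n : nat) (c : {ffun 'I_n -> 'I_3}).

Lemma closed_nbhd_cycle (v : 'I_n) :
  closed_nbhd (@cycle_graph n) v = [set v; ordS v; ord_pred v].
Proof.
apply/setP => u; rewrite !inE orbA -/(cycle_graph u v) /cycle_graph.
by rewrite -(inj_eq (@ordS_inj n) u (ord_pred v)) ord_predK (eq_sym v).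
Qed.

Lemma properP :
  proper_coloring (@cycle_graph n) c <-> forall v, c v != c (ordS v).
Proof.
split=> [P v|P u v]; first by apply: P; rewrite /cycle_graph eqxx.
by case/orP=> /eqP ->; rewrite // eq_sym.
Qed.

Lemma CDV_of_distinct (v : 'I_n) :
  c v != c (ordS v) -> c v != c (ord_pred v) -> c (ordS v) != c (ord_pred v) ->
  is_CDV (@cycle_graph n) c v.
Proof.
move=> h1 h2 h3; apply/subsetP => a _.
rewrite closed_nbhd_cycle.
by case/or3P: (ord3_exhausted a h1 h2 h3) => /eqP ->;
  apply: imset_f; rewrite !inE eqxx ?orbT.
Qed.

Hypothesis cP : proper_coloring (@cycle_graph n) c.
Hypothesis cT : #|colors_used c| = 3%N.

Lemma proper_succ v : c v != c (ordS v).
Proof. by case: properP => H _; apply: H. Qed.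

Lemma proper_pred v : c v != c (ord_pred v).
Proof. by have := proper_succ (ord_pred v); rewrite ord_predK eq_sym. Qed.

(** If both neighbors share a color, the closed neighborhood shows only two of the three colors in
    use. *)
Lemma is_CDV_cycle v :
  is_CDV (@cycle_graph n) c v = (c (ordS v) != c (ord_pred v)).
Proof.
apply/idP/idP => [H|]; last exact: CDV_of_distinct (proper_succ v) (proper_pred v).
apply/eqP => E; move/subset_leq_card: H; rewrite cT closed_nbhd_cycle.
rewrite imsetU imsetU1 !imset_set1 E -setUA setUid.
by rewrite cards2; case: eqP.
Qed.

Definition edges (i j : 'I_3) : nat :=
  \sum_(v < n) (((c v == i) && (c (ordS v) == j)) +
                ((c v == j) && (c (ordS v) == i)))%N.

Lemma edgesE i j : i != j ->
  exists d, edges i j = (#|class_CDVs (@cycle_graph n) c i| + 2 * d)%N.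
Proof.
move=> nij.
(* The witness counts the vertices of color [i] with both neighbors of color [j]: the non-CDVs that
   contribute 2. *)
exists (\sum_(v < n) [&& c v == i, c (ordS v) == j & c (ord_pred v) == j])%N.
rewrite /edges big_split /=.
(* Shifting the second summand by [ord_pred] charges each edge to its end of color [i]. *)
rewrite [X in (_ + X)%N = _](reindex_inj (@ord_pred_inj n)) /=.
rewrite -sum1dep_card [in RHS]big_mkcond /= big_distrr /= -!big_split /=.
apply: eq_bigr => v _; rewrite ord_predK is_CDV_cycle.
have := proper_succ v; have := proper_pred v.
move: (c v) (c (ordS v)) (c (ord_pred v)) => x y z.
case: (eqVneq x i) => [->|_] h1 h2; last by rewrite andbF.
rewrite /= andbT.
case: (eqVneq y z) => [->|yz]; first by case: eqP.
case/or3P: (ord3_exhausted j h2 h1 yz) => /eqP jE.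
- by rewrite jE eqxx in nij.
- by rewrite jE eqxx eq_sym (negPf yz).
- by rewrite jE eqxx (negPf yz).
Qed.

(** Each edge joins two distinct colors, so exactly one of the three sums counts it. *)
Lemma edges_total i j l : i != j -> i != l -> j != l ->
  (edges i j + edges i l + edges j l = n)%N.
Proof.
move=> ij il jl; rewrite /edges -!big_split /= -[RHS]card_ord -sum1_card.
apply: eq_bigr => v _; have := proper_succ v.
move: (c v) (c (ordS v)) => x y.
have ijF := (negPf ij, negPf il, negPf jl).
have jiF : ((j == i) = false) * ((l == i) = false) * ((l == j) = false).
  by rewrite !(eq_sym _ i) (eq_sym l) !ijF.
by case/or3P: (ord3_exhausted x ij il jl) => /eqP ->;
  case/or3P: (ord3_exhausted y ij il jl) => /eqP ->;
  rewrite ?eqxx ?ijF ?jiF.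
Qed.

(** With [l] the third color, the edges [ij] and [il] are counted from their ends of color [i], the
    edges [jl] from color [j]; hence the coefficients 2 and 1. *)
Lemma CDV_count i j : i != j -> exists d,
  n = (2 * #|class_CDVs (@cycle_graph n) c i|
       + #|class_CDVs (@cycle_graph n) c j| + 2 * d)%N.
Proof.
move=> ij.
have [l il jl] : exists2 l, i != l & j != l.
  have : (0 < #|~: [set i; j]|)%N.
    by rewrite cardsCs setCK card_ord cards2 ij.
  case/card_gt0P => l; rewrite !inE negb_or => /andP[h1 h2].
  by exists l; rewrite eq_sym.
have [d1 E1] := edgesE ij; have [d2 E2] := edgesE il.
have [d3 E3] := edgesE jl.
by exists (d1 + d2 + d3)%N; rewrite -{1}(edges_total ij il jl); lia.
Qed.

End CycleColoring.

(** * Sufficiency: coloring the cycle by a periodic word *)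

(* The letters of (012)^b (0102)^e (02)^d, with (02) repeated forever; every
   block starts with 0 and ends with 2, so the blocks do not interfere, also
   around the end of the cycle. *)
Definition word (b e m : nat) : nat :=
  (if m < 3 * b then m %% 3
   else if odd (m - 3 * b) then
     if (m < 3 * b + 4 * e) && ((m - 3 * b) %% 4 == 1) then 1 else 2
   else 0)%N.

Lemma word_lt3 b e m : (word b e m < 3)%N.
Proof.
by rewrite /word; case: ifP => _; do ?case: ifP => _ //; rewrite ltn_pmod.
Qed.

Lemma word_succ b e m : word b e m != word b e m.+1.
Proof. by rewrite /word; do ![case: ifP => ?]; lia. Qed.

Lemma word0 b e : word b e 0 = 0%N.
Proof. by rewrite /word; case: ifP. Qed.

Lemma word_block012 b e i r : (i < b)%N -> (r < 3)%N ->
  word b e (3 * i + r) = r.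
Proof. by move=> ib r3; rewrite /word; do ![case: ifP => ?]; lia. Qed.

(** Even [i] gives the first 0 of a block [0102], odd [i] the second; either way its neighbors are a
    1 and a 2. The guard excludes position 0, whose predecessor wraps around. *)
Lemma word_block0102 b e i : (i < 2 * e)%N ->
  [/\ word b e (3 * b + 2 * i) = 0,
      word b e (3 * b + 2 * i).+1 = if odd i then 2 else 1 &
      (0 < b + i -> word b e (3 * b + 2 * i).-1 = if odd i then 1 else 2)]%N.
Proof. by move=> ie; rewrite /word; split; do ![case: ifP => ?]; lia. Qed.

Lemma word_last b e d : (0 < b)%N ->
  word b e (3 * b + 4 * e + 2 * d).-1 = 2%N.
Proof. by move=> b0; rewrite /word; do ![case: ifP => ?]; lia. Qed.

Section WordColoring.
Variables (n b e d : nat).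
Hypotheses (b_gt0 : (0 < b)%N) (nE : n = (3 * b + 4 * e + 2 * d)%N).

Definition word_coloring : {ffun 'I_n -> 'I_3} :=
  [ffun v => Ordinal (word_lt3 b e (v : 'I_n))].
Local Notation c := word_coloring.

Lemma word_coloringE v : c v = word b e v :> nat.
Proof. by rewrite ffunE. Qed.

Lemma word_coloring_succ v : c (ordS v) = word b e v.+1 :> nat.
Proof.
rewrite ffunE /=; have := ltn_ord v; rewrite leq_eqVlt => /orP[/eqP vn|lt].
  (* The last vertex is followed by vertex 0, and the infinite word also has 0 at position [n]. *)
  rewrite vn modnn word0 /word nE; do ![case: ifP => ?]; lia.
by rewrite modn_small.
Qed.

Lemma word_coloring_pred v :
  c (ord_pred v) = (if v : nat is m.+1 then word b e m else 2%N) :> nat.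
Proof.
rewrite ffunE /=; case: v => [[|m] /= lt].
  by rewrite add0n modn_small ?prednK // nE word_last.
by rewrite /= modnDr modn_small // ltnW.
Qed.

Lemma word_coloring_proper : proper_coloring (@cycle_graph n) c.
Proof.
apply/properP => v.
by rewrite -val_eqE /= word_coloringE word_coloring_succ word_succ.
Qed.

Lemma word_coloring_CDV v : c (ordS v) != c (ord_pred v) ->
  v \in class_CDVs (@cycle_graph n) c (c v).
Proof.
move=> h; rewrite inE eqxx; apply: CDV_of_distinct h.
  exact: proper_succ word_coloring_proper v.
exact: proper_pred word_coloring_proper v.
Qed.

Lemma card_class_CDVs_ge a (i : 'I_3) (f : nat -> nat) :
  (forall k, (k < a)%N -> (f k < n)%N) -> {in gtn a &, injective f} ->
  (forall (v : 'I_n) k, (k < a)%N -> v = f k :> nat ->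
     c v = i /\ c (ordS v) != c (ord_pred v)) ->
  (a <= #|class_CDVs (@cycle_graph n) c i|)%N.
Proof.
move=> fn finj fC.
pose g (k : 'I_a) : 'I_n := Ordinal (fn k (ltn_ord k)).
have ginj : injective g.
  move=> k l /(congr1 val) /= kl; apply: val_inj; apply: finj kl; exact: ltn_ord.
rewrite -[leqLHS]card_ord -(card_codom ginj); apply/subset_leq_card/subsetP => v.
case/codomP => k ->; have [E h] := fC (g k) k (ltn_ord k) erefl.
by rewrite -E; apply: word_coloring_CDV.
Qed.

Lemma word_class0 : (b + 2 * e <= #|class_CDVs (@cycle_graph n) c (0 : 'I_3)%R|)%N.
Proof.
(* [f] lists the 0 of each block [012], then both 0s of each block [0102]. *)
pose f k := (if k < b then 3 * k + 0 else 3 * b + 2 * (k - b))%N.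
apply: (@card_class_CDVs_ge _ _ f) => [k|k l|v k ka]; rewrite /f.
- rewrite nE; case: ifP; lia.
- rewrite !inE; do ![case: ifP => ?]; lia.
move=> vE; rewrite -!val_eqE /= word_coloring_succ word_coloring_pred vE.
suff: word b e v = 0%N /\ word b e v.+1 !=
    (if v : nat is m.+1 then word b e m else 2%N) :> nat.
  case=> v0; rewrite vE => ->; split=> //; apply: val_inj.
  by rewrite /= word_coloringE.
rewrite vE; case: ifP => kb.
  rewrite -addnS !word_block012 //; split=> //.
  case: k {ka vE} kb => [//|k] kb.
  have -> : (3 * k.+1 + 0 = (3 * k + 2).+1)%N by lia.
  by rewrite word_block012 // ltnW.
have [-> -> H] := @word_block0102 b e (k - b)%N ltac:(lia).
split=> //; move: (H ltac:(lia)).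
case mE: (3 * b + _)%N => [|m] /=; [by lia | move=> ->].
by case: odd.
Qed.

Lemma word_class1 : (b <= #|class_CDVs (@cycle_graph n) c (1 : 'I_3)%R|)%N.
Proof.
apply: (@card_class_CDVs_ge _ _ (fun k => 3 * k + 1)%N) => [k|k l|v k kb].
- rewrite nE; lia.
- rewrite !inE; lia.
move=> vE; split.
  by apply: val_inj; rewrite /= word_coloringE vE word_block012.
rewrite -val_eqE /= word_coloring_succ word_coloring_pred vE.
by rewrite -addnS addn1 word_block012 // -[(3 * k)%N]addn0 word_block012.
Qed.

Lemma word_class2 : (b <= #|class_CDVs (@cycle_graph n) c (2%:R : 'I_3)%R|)%N.
Proof.
apply: (@card_class_CDVs_ge _ _ (fun k => 3 * k + 2)%N) => [k|k l|v k kb].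
- rewrite nE; lia.
- rewrite !inE; lia.
move=> vE; split.
  by apply: val_inj; rewrite /= word_coloringE vE word_block012.
rewrite -val_eqE /= word_coloring_succ word_coloring_pred vE.
have -> : (3 * k + 2 = (3 * k + 1).+1)%N by lia.
rewrite [X in _ != X]/= (word_block012 _ kb) //.
have -> : ((3 * k + 1).+2 = 3 * k.+1 + 0)%N by lia.
have [kb'|kb'] := ltnP k.+1 b; first by rewrite word_block012.
(* Behind the last block [012] the word has 0 at position [3 * b], whatever follows. *)
have -> : (3 * k.+1 + 0 = 3 * b + 0)%N by lia.
rewrite /word; do ![case: ifP => ?]; lia.
Qed.

End WordColoring.

(** * Triples of integers and the realization criterion *)

Lemma ord3_ind (P : 'I_3 -> Prop) : P 0 -> P 1 -> P 2%:R -> forall i, P i.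
Proof.
move=> P0 P1 P2 [[|[|[|]]]] //= p.
- by rewrite (_ : Ordinal p = 0); last apply: val_inj.
- by rewrite (_ : Ordinal p = 1); last apply: val_inj.
- by rewrite (_ : Ordinal p = 2%:R); last apply: val_inj.
Qed.

Lemma forall_ord3 (P : 'I_3 -> Prop) :
  (forall i, P i) <-> [/\ P 0, P 1 & P 2%:R].
Proof. by split=> [H|[]]; [split | exact: ord3_ind]. Qed.

Lemma triple_eta (s : triple) : exists a b c : int, s = [tuple a; b; c].
Proof.
exists (tnth s 0), (tnth s 1), (tnth s 2%:R).
by apply: eq_from_tnth; elim/ord3_ind; rewrite [RHS](tnth_nth 0).
Qed.

Lemma three_termE (a b c : int) :
  three_term [tuple a; b; c] <-> (0 < c) && (c <= b) && (b <= a).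
Proof.
split.
  move=> [H0 H]; have := H0 2%:R; have := H 0 1 isT; have := H 1 2%:R isT.
  by rewrite !(tnth_nth 0) /= => -> -> ->.
move=> /andP[/andP[c0 cb] ba]; split.
  by elim/ord3_ind; rewrite (tnth_nth 0) /=; lia.
by elim/ord3_ind; elim/ord3_ind; rewrite !(tnth_nth 0) /=; lia.
Qed.

Lemma triple_leE (a b c a' b' c' : int) :
  triple_le [tuple a; b; c] [tuple a'; b'; c'] <->
  (a <= a') && (b <= b') && (c <= c').
Proof.
rewrite /triple_le forall_ord3 !(tnth_nth 0) /=.
by split=> [[-> -> ->]|/andP[/andP[]]].
Qed.

(** This is [(a - p) / 2] rounded up, which makes [parity_ceil p a] the least integer of parity [p]
    that is at least [a]. *)
Definition half_ceil (p : bool) (a : int) : int := ((a + 1 - (p : nat)%:Z) %/ 2)%Z.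

Definition parity_ceil (p : bool) (a : int) : int :=
  2 * half_ceil p a + (p : nat)%:Z.

Lemma parity_ceilP p a : a <= parity_ceil p a <= a + 1.
Proof. rewrite /parity_ceil /half_ceil; lia. Qed.

(** The entry [c] drops out: the word gives colors 1 and 2 the same bound, and [c <= b]. *)
Lemma realizes_cycle (n : nat) (a b c : int) :
  (3 <= n)%N -> three_term [tuple a; b; c] ->
  realizes (@cycle_graph n) [tuple a; b; c] <->
  2 * parity_ceil (odd n) a + parity_ceil (odd n) b <= n%:Z.
Proof.
move=> n3 /three_termE abc; have := parity_ceilP (odd n) b.
have := parity_ceilP (odd n) a; rewrite /parity_ceil.
set x := half_ceil _ a; set y := half_ceil _ b.
set p : int := (odd n : nat)%:Z => xE yE; split.
  case=> f [[fP _] fT]; rewrite forall_ord3 !(tnth_nth 0) /= => -[A B _].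
  (* The count in both orders gives both class sizes the parity of [n], so they reach the parity
     ceilings. *)
  have [|u U] := @CDV_count n f fP fT 0 1; first by [].
  have [|v V] := @CDV_count n f fP fT 1 0; first by [].
  move: U V A B; set k := #|_|; set l := #|_|; lia.
move=> le.
(* Here [m] is the parity ceiling of [b] and [m + 2 * e] that of [a]; what is left of [n] is even,
   and nonnegative by the criterion. *)
have [m mE] : exists m : nat, m%:Z = 2 * y + p by exists `|(2 * y + p)%R|%N; lia.
have [e eE] : exists e : nat, e%:Z = x - y by exists `|(x - y)%R|%N; lia.
have [d dE] : exists d : nat, n = (3 * m + 4 * e + 2 * d)%N.
  exists ((n - (3 * m + 4 * e))./2)%N; lia.
have m0 : (0 < m)%N by lia.
have [C0 C1 C2] := And3 (word_class0 m0 dE) (word_class1 m0 dE)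
  (word_class2 m0 dE).
exists (word_coloring n m e).
(* A CDV in every class yields both the b-coloring and the use of all three colors. *)
have cl i : (0 < #|class_CDVs (@cycle_graph n) (word_coloring n m e) i|)%N.
  elim/ord3_ind: i; lia.
split.
- split=> [|i _]; first exact: word_coloring_proper dE.
  by have /card_gt0P := cl i.
- rewrite (_ : colors_used _ = setT) ?cardsT ?card_ord //.
  apply/setP => i; rewrite inE; have /card_gt0P[v] := cl i.
  by rewrite inE => /andP[/eqP <- _]; apply: imset_f.
by elim/ord3_ind; rewrite (tnth_nth 0) [nth _ _ _]/=; lia.
Qed.

Lemma realizes_le (T : finType) (e : rel T) (s t : triple) :
  triple_le s t -> realizes e t -> realizes e s.
Proof.
by move=> st [c [cb c3 ct]]; exists c; split=> // i; apply: le_trans (ct i).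
Qed.

(** * The families, by linear arithmetic on the criterion *)

Definition sorted_pos (a b c : int) : bool := (0 < c) && (c <= b) && (b <= a).

Definition cycle_ok (n : nat) (a b : int) : bool :=
  2 * parity_ceil (odd n) a + parity_ceil (odd n) b <= n%:Z.

(** The criterion turns maximality into a statement on integers, which [lia] settles for each
    residue. *)
Lemma maximal_realized_cycle (n : nat) (a b c : int) : (3 <= n)%N ->
  sorted_pos a b c -> cycle_ok n a b ->
  (forall a' b' c', sorted_pos a' b' c' -> cycle_ok n a' b' ->
     (a <= a') && (b <= b') && (c <= c') ->
     [/\ a' = a, b' = b & c' = c]) ->
  maximal_realized (@cycle_graph n) [tuple a; b; c].
Proof.
move=> n3 /three_termE abc ok amax; split=> //; first by apply/realizes_cycle.
move=> t; have [a' [b' [c' ->]]] := triple_eta t => abc' /realizes_cycle ok' le.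
suff [-> -> ->] : [/\ a' = a, b' = b & c' = c] by [].
apply: amax; first by apply/three_termE.
  by apply: ok'.
by apply/triple_leE.
Qed.

Lemma minimal_not_realized_cycle (n : nat) (a b c : int) : (3 <= n)%N ->
  sorted_pos a b c -> ~~ cycle_ok n a b ->
  (forall a' b' c', sorted_pos a' b' c' -> ~~ cycle_ok n a' b' ->
     (a' <= a) && (b' <= b) && (c' <= c) ->
     [/\ a' = a, b' = b & c' = c]) ->
  minimal_not_realized (@cycle_graph n) [tuple a; b; c].
Proof.
move=> n3 /three_termE abc ok amin; split=> //.
  by move/realizes_cycle => /(_ n3 abc); apply/negP.
move=> t; have [a' [b' [c' ->]]] := triple_eta t => abc' nr le.
suff [-> -> ->] : [/\ a' = a, b' = b & c' = c] by [].
apply: amin; first by apply/three_termE.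
  by apply/negP => ok'; apply: nr; apply/realizes_cycle.
by apply/triple_leE.
Qed.

Lemma odd_12kD k j : odd (12 * k + j)%N = odd j.
Proof. by rewrite oddD oddM. Qed.

Ltac cycle_lia :=
  rewrite /sorted_pos /cycle_ok /parity_ceil /half_ceil ?odd_12kD /=;
  try (move=> abc ok le; split); lia.

Ltac case_family :=
  first [move=> [[i [iR ->]]|->] | move=> [i [iR ->]]].

Lemma R_set_maximal k j t : (5 <= 12 * k + j)%N -> (j < 12)%N ->
  R_set k j t -> maximal_realized (@cycle_graph (12 * k + j)) t.
Proof.
move=> n5 j12.
do 12! [case: j n5 j12 => [|j] n5 j12; first by
  case_family; apply: maximal_realized_cycle => [|||a' b' c']; cycle_lia].
by [].
Qed.

Lemma U_set_minimal k j t : (5 <= 12 * k + j)%N -> (j < 12)%N ->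
  U_set k j t -> minimal_not_realized (@cycle_graph (12 * k + j)) t.
Proof.
move=> n5 j12.
do 12! [case: j n5 j12 => [|j] n5 j12; first by
  case_family; apply: minimal_not_realized_cycle => [|||a' b' c']; cycle_lia].
by [].
Qed.

Ltac below_family i :=
  first [refine (ex_intro _ _ (conj (ex_intro _ i (conj _ erefl)) _))
        |refine (ex_intro _ _ (conj (or_introl (ex_intro _ i (conj _ erefl))) _))];
  rewrite ?triple_leE; cycle_lia.

Ltac below_exceptional :=
  refine (ex_intro _ _ (conj (or_intror erefl) _)); rewrite triple_leE; cycle_lia.

(* [r] and [u] make [3 k + r - x] and [3 k + u - x] the indices at which the
   first entries of the two families are the parity ceiling of [a], resp. one
   less; [lo] is the least index of the second family. *)
Ltac R_or_U_at K x r lo u :=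
  case=> ?;
  [> left; destruct (lerP (3 * K + r - x) K);
     first [below_family (Num.min K (3 * K + r - x)) | below_exceptional]
   | right; below_family (Num.max lo (3 * K + u - x))].

(** The first entry [a] dictates the index. For small [a] the index in [R_set] exceeds [k], and the
    last member or the exceptional triple serves; for large [a] the index in [U_set] is raised to
    its least value. *)
Lemma R_or_U k j a b c : (5 <= 12 * k + j)%N -> (j < 12)%N ->
  sorted_pos a b c ->
  (exists t, R_set k j t /\ triple_le [tuple a; b; c] t) \/
  (exists t, U_set k j t /\ triple_le t [tuple a; b; c]).
Proof.
move=> n5 j12 abc; have : cycle_ok (12 * k + j) a b \/ ~~ cycle_ok (12 * k + j) a b.
  by case: cycle_ok; [left | right].
have := erefl (half_ceil (odd j) a); move: {-1}(half_ceil _ _) => x.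
move: abc; rewrite /sorted_pos /cycle_ok /parity_ceil odd_12kD => abc.
case: j n5 j12 => [|[|[|[|[|[|[|[|[|[|[|[|j]]]]]]]]]]]] n5 // _.
all: rewrite /half_ceil /= => xE.
- R_or_U_at k%:Z x 0%Z 1%Z 1%Z.
- R_or_U_at k%:Z x 0%Z 0%Z 0%Z.
- R_or_U_at k%:Z x 1%Z 0%Z 1%Z.
- R_or_U_at k%:Z x 0%Z 0%Z 1%Z.
- R_or_U_at k%:Z x 1%Z 0%Z 1%Z.
- R_or_U_at k%:Z x 1%Z 0%Z 1%Z.
- R_or_U_at k%:Z x 1%Z 0%Z 2%Z.
- R_or_U_at k%:Z x 1%Z (-1)%Z 1%Z.
- R_or_U_at k%:Z x 2%Z 0%Z 2%Z.
- R_or_U_at k%:Z x 1%Z 0%Z 2%Z.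
- R_or_U_at k%:Z x 2%Z (-1)%Z 2%Z.
- R_or_U_at k%:Z x 2%Z (-1)%Z 2%Z.
Qed.

Theorem proposition4p7 :
  [/\ forall s : triple, three_term s ->
        (realizes (@cycle_graph 3) s <-> s = [tuple 1; 1; 1]),
      forall s : triple, three_term s -> ~ realizes (@cycle_graph 4) s &
      forall n k j : nat, (5 <= n)%N -> n = (12 * k + j)%N -> (j < 12)%N ->
        [/\ forall t : triple, R_set k j t ->
              maximal_realized (@cycle_graph n) t,
            forall t : triple, U_set k j t ->
              minimal_not_realized (@cycle_graph n) t &
            forall s : triple, three_term s ->
              [/\ (exists t, R_set k j t /\ triple_le s t) \/
                  (exists t, U_set k j t /\ triple_le t s),
                  (exists t, R_set k j t /\ triple_le s t) ->
                    realizes (@cycle_graph n) s &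
                  (exists t, U_set k j t /\ triple_le t s) ->
                    ~ realizes (@cycle_graph n) s]]].
Proof.
split.
- move=> s; have [a [b [c ->]]] := triple_eta s => abc.
  (* The odd ceilings satisfy [2 * a' + b' <= 3], so both are 1. *)
  rewrite realizes_cycle // /parity_ceil /half_ceil /=.
  move/three_termE: abc => abc; split=> [le|[-> -> _] //].
  by suff [-> -> ->] : [/\ a = 1, b = 1 & c = 1] by []; split; lia.
- move=> s; have [a [b [c ->]]] := triple_eta s => abc.
  (* Even ceilings of positive entries are at least 2, so [2 * a' + b'] is at least 6. *)
  rewrite realizes_cycle // /parity_ceil /half_ceil /=.
  by move/three_termE: abc => abc; lia.
move=> n k j n5 nE j12; subst n; split=> [t|t|s].
- exact: R_set_maximal.
- exact: U_set_minimal.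
have [a [b [c ->]]] := triple_eta s => /three_termE abc; split.
- exact: R_or_U.
- case=> t [tR st]; have [_ r _] := R_set_maximal n5 j12 tR.
  exact: realizes_le st r.
- case=> t [tU ts]; have [_ nr _] := U_set_minimal n5 j12 tU.
  by move=> r; apply: nr; apply: realizes_le ts r.
Qed.
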